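(* Let $f\colon X\to\overline{\mathbb{R}}$ be a proper e-convex function with $x_0\in\operatorname{dom}f$ and $\partial_c f(x_0)=\operatorname{dom}f^c$. Then, for all $x\in X$, $$f(x)=f(x_0)+\sup_{(x^*,u^*,\alpha)\in\partial_c f(x_0)}\big\{c(x,(x^*,u^*,\alpha))-c(x_0,(x^*,u^*,\alpha))\big\}.$$
   Context: $X$ is a nontrivial separated (Hausdorff) real locally convex space with continuous dual $X^*$; $X$ carries the topology $\sigma(X,X^* )$ and $X^*$ the topology $\sigma(X^*,X)$; $\langle x,x^*\rangle$ is the value of $x^*\in X^*$ at $x\in X$. $\overline{\mathbb{R}}=\mathbb{R}\cup\{\pm\infty\}$. $W:=X^*\times X^*\times\mathbb{R}$. For an extended-real-valued function $h$, $\operatorname{dom}h=\{h<+\infty\}$; $h$ is proper if it never takes the value $-\infty$ and $\operatorname{dom}h\neq\emptyset$. A subset $C$ of a locally convex space $Y$ is e-convex if for every $y_0\notin C$ there is $y^*\in Y^*$ with $\langle y-y_0,y^*\rangle<0$ for all $y\in C$. A function $f\colon X\to\overline{\mathbb{R}}$ is e-convex if its epigraph $\{(x,r)\in X\times\mathbb{R}:f(x)\le r\}$ is e-convex in $X\times\mathbb{R}$. Coupling function: $c(x,(x^*,u^*,\alpha)):=\langle x,x^*\rangle$ if $\langle x,u^*\rangle<\alpha$, and $+\infty$ otherwise. The $c$-conjugate of $f$ is $f^c\colon W\to\overline{\mathbb{R}}$, $f^c(w):=\sup_{x\in X}\{c(x,w)-f(x)\}$, with the convention $(+\infty)-(+\infty)=-\infty$.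 $c$-subdifferential: for $f$ proper with $f(x_0)\in\mathbb{R}$, $\partial_c f(x_0)$ is the set of $w=(x^*,u^*,\alpha)\in W$ such that $\langle x_0,u^*\rangle<\alpha$ and $f(x)-f(x_0)\ge c(x,w)-c(x_0,w)$ for all $x\in X$. *)

(* Defs.v *)
From HB Require Import structures.
From mathcomp Require Import all_boot all_order all_algebra.
From mathcomp Require Import all_classical all_reals all_analysis.

Set Implicit Arguments.
Unset Strict Implicit.
Unset Printing Implicit Defensive.

Import Order.TTheory GRing.Theory Num.Theory.
Import numFieldNormedType.Exports.

Local Open Scope classical_set_scope.
Local Open Scope ring_scope.

(* In this version of the library a [tvsType] is locally convex by definition.

   The dual is taken for the given topology of [X], which may be sigma(X, X')
   itself. Passing to the weak topology changes neither the continuous linear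
   functionals on X nor those on X * R. *)
Record topDual (R : realType) (X : tvsType R) : Type := TopDual {
  topDual_fun :> {linear X -> R^o};
  topDual_continuous : continuous (topDual_fun : X -> R^o) }.

Definition e_convex_set (R : realType) (Y : tvsType R) (C : set Y) : Prop :=
  forall y0 : Y, ~ C y0 ->
    exists y' : topDual Y, forall y : Y, C y -> (y' (y - y0) : R) < 0.

Definition epigraph (R : realType) (X : tvsType R) (f : X -> \bar R) :
    set (X * R^o)%type :=
  [set p | (f p.1 <= (p.2 : R)%:E)%E].

Definition e_convex (R : realType) (X : tvsType R) (f : X -> \bar R) : Prop :=
  e_convex_set (epigraph f).

Definition edom (R : realType) (T : Type) (h : T -> \bar R) : set T :=
  [set t | (h t < +oo)%E].

Definition eproper (R : realType) (T : Type) (h : T -> \bar R) : Prop :=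
  (forall t : T, h t <> -oo%E) /\ edom h !=set0.

(* A triple (x^*, u^*, alpha) is encoded as ((x^*, u^* ), alpha). *)
Definition couplingDual (R : realType) (X : tvsType R) : Type :=
  (topDual X * topDual X * R)%type.

Definition coupling (R : realType) (X : tvsType R) (x : X)
    (w : couplingDual X) : \bar R :=
  let: (x', u', alpha) := w in
  if (u' x : R) < alpha then (x' x : R)%:E else +oo%E.

(* Extended-real addition of the library satisfies (+oo) - (+oo) = -oo. *)
Definition c_conjugate (R : realType) (X : tvsType R) (f : X -> \bar R)
    (w : couplingDual X) : \bar R :=
  ereal_sup [set (coupling x w - f x)%E | x in [set: X]].

(* Meaningful when [f] is proper and [f x0] is finite. *)
Definition c_subdiff (R : realType) (X : tvsType R) (f : X -> \bar R)
    (x0 : X) : set (couplingDual X) :=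
  [set w : couplingDual X | (w.1.2 x0 : R) < w.2 /\
     forall x : X, (coupling x w - coupling x0 w <= f x - f x0)%E].

(* Main.v *)
(* A point (x, r) strictly below the graph of f is separated from the epigraph
   by a closed hyperplane. If it is not vertical, its slope a gives the point
   (a, 0, 1) of dom f^c, hence a c-subgradient at x0, and the corresponding
   term exceeds r. If it is vertical, with horizontal part u, then x lies
   outside dom f; pairing (u, u(x)) with the slope of a continuous affine
   minorant of f gives a c-subgradient at x0 whose coupling with x is +oo. Such
   a minorant exists since a hyperplane through a point below (x0, f(x0))
   cannot be vertical. *)
Require Import Defs.
From HB Require Import structures.
From mathcomp Require Import all_boot all_order all_algebra.
From mathcomp Require Import all_classical all_reals all_analysis.
From mathcomp Require Import lra.
Import Order.TTheory GRing.Theory Num.Theory.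
Import numFieldNormedType.Exports.
Local Open Scope classical_set_scope.
Local Open Scope ring_scope.

Lemma topDual_exists (R : realType) (X : tvsType R) (g : X -> R^o) :
  linear g -> continuous g -> exists a : topDual X, forall x, a x = g x.
Proof.
move=> g_linear g_continuous.
pose gL := HB.pack_for {linear X -> R^o} g
  (GRing.isLinear.Build R X R^o _ g g_linear).
by exists (@TopDual _ _ gL g_continuous).
Qed.

Lemma topDual_prod_slice (R : realType) (X : tvsType R)
    (phi : topDual (X * R^o)%type) (k : R) :
  exists a : topDual X, forall x, (a x : R) = k * (phi (x, 0) : R).
Proof.
apply: (topDual_exists R X (fun x => k *: phi (x, 0))).
  move=> c u v.
  have -> : (c *: u + v, 0 : R^o) = c *: (u, 0 : R^o) + (v, 0 : R^o).
    by congr (_, _) => /=; rewrite scaler0 addr0.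
  by rewrite linearP scalerDr !scalerA [k * c]mulrC.
have inl_continuous : continuous (fun x : X => (x, 0 : R^o)).
  by move=> x; exact: (cvg_pair cvg_id (cvg_cst _)).
move=> x; apply: cvgZl_tmp.
apply: (@cvg_comp _ _ _ (fun x : X => (x, 0)) phi _ _ _ (inl_continuous x)).
exact: topDual_continuous.
Qed.

Lemma topDual_prodE (R : realType) (X : tvsType R)
    (phi : topDual (X * R^o)%type) (x : X) (s : R) :
  (phi (x, s) : R) = (phi (x, 0) : R) + s * (phi (0, 1) : R).
Proof.
have -> : (x, s) = (x, 0) + s *: (0, 1) :> (X * R^o)%type.
  congr (_, _) => /=; first by rewrite scaler0 addr0.
  by rewrite add0r; symmetry; exact: mulr1.
by rewrite linearD linearZ.
Qed.

(** The sign of the vertical component [b] of the separating functional decides: [b > 0] is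
    impossible since the epigraph is unbounded upwards, [b = 0] gives [u], and for [b < 0] dividing
    by [- b] gives [a]. *)
Lemma epigraph_separation (R : realType) (X : tvsType R) (f : X -> \bar R)
    (x : X) (r : R) :
  eproper f -> e_convex f -> (r%:E < f x)%E ->
  (exists a : topDual X, forall (y : X) (s : R), (f y <= s%:E)%E ->
     (a y : R) - s < (a x : R) - r) \/
  (exists u : topDual X, forall y : X, edom f y -> (u y : R) < (u x : R)).
Proof.
move=> [f_nny [z z_dom]] f_cvx lt_r_fx.
have [|phi phiP] := f_cvx (x, r); first by rewrite /epigraph /= leNgt lt_r_fx.
set b : R := phi (0, 1).
have sep y s : (f y <= s%:E)%E ->
    (phi (y, 0) : R) + s * b < (phi (x, 0) : R) + r * b.
  move=> fys; have := phiP (y, s) fys.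
  by rewrite linearB subr_lt0 (topDual_prodE _ _ phi x r) (topDual_prodE _ _ phi y s).
have domP y : edom f y -> exists t : R, f y = t%:E.
  rewrite /edom /=; case E : (f y) => [t| |] // _; first by exists t.
  by have := f_nny y; rewrite E.
have [t fz] := domP z z_dom.
have b_le0 : b <= 0.
  rewrite leNgt; apply/negP => b_gt0.
  (* High enough for [(z, s)] to lie in the epigraph and for [s * b] to close the gap, against
     [sep]. *)
  pose s := Num.max t (((phi (x, 0) : R) + r * b - (phi (z, 0) : R)) / b).
  have /sep : (f z <= s%:E)%E by rewrite fz lee_fin le_max lexx.
  apply/negP; rewrite -leNgt -lerBlDl -ler_pdivrMr //.
  by rewrite le_max lexx orbT.
have [b0|b_neq0] := eqVneq b 0.
  right; have [u uE] := topDual_prod_slice _ _ phi 1.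
  exists u => y /domP[s fy]; have := sep y s.
  by rewrite fy lexx b0 !mulr0 !addr0 !uE !mul1r; exact.
have b_lt0 : b < 0 by rewrite lt_neqAle b_neq0.
left; have [a aE] := topDual_prod_slice _ _ phi (- b^-1).
exists a => y s /sep; rewrite !aE.
have binv_lt0 : b^-1 < 0 by rewrite invr_lt0.
by rewrite -(ltr_nM2r binv_lt0) !mulrDl !mulfK //; lra.
Qed.

(** On [edom f] the bound on [u] keeps the coupling finite; elsewhere the convention for infinite
    differences makes the term [-oo]. *)
Lemma edom_c_conjugate (R : realType) (X : tvsType R) (f : X -> \bar R)
    (a u : topDual X) (alpha m : R) :
  eproper f ->
  (forall (y : X) (s : R), (f y <= s%:E)%E -> (a y : R) - s <= m) ->
  (forall y : X, edom f y -> (u y : R) < alpha) ->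
  edom (c_conjugate f) (a, u, alpha).
Proof.
move=> [f_nny _] a_le u_lt; apply: le_lt_trans (ltry m).
apply: ge_ereal_sup => _ [y _ <-].
case E : (f y) => [s| |]; last by have := f_nny y; rewrite E.
- rewrite /coupling u_lt; last by rewrite /edom /= E ltry.
  by rewrite -EFinB lee_fin a_le // E.
- by rewrite addeNy leNye.
Qed.

Theorem proposition4p3 (R : realType) (X : tvsType R)
    (X_nontrivial : exists x : X, x != 0)
    (X_separated : hausdorff_space X)
    (f : X -> \bar R) (f_proper : eproper f) (f_e_convex : e_convex f)
    (x0 : X) (x0_dom : edom f x0)
    (subdiff_eq_dom : c_subdiff f x0 = edom (c_conjugate f)) :
  forall x : X,
    f x = (f x0 + ereal_sup [set (coupling x w - coupling x0 w)%E
                            | w in c_subdiff f x0])%E.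
Proof.
move=> x; have [f_nny _] := f_proper.
have [t0 fx0] : exists t : R, f x0 = t%:E.
  move: x0_dom; rewrite /edom /=; case E : (f x0) => [t| |] // _.
    by exists t.
  by have := f_nny x0; rewrite E.
apply/eqP; rewrite eq_le; apply/andP; split; last first.
  rewrite fx0 -leeBrDl //; apply: ge_ereal_sup => _ [w [_ w_sub] <-].
  by have := w_sub x; rewrite fx0.
have [a0 a0P] : exists a : topDual X, forall (y : X) (s : R),
    (f y <= s%:E)%E -> (a y : R) - s < (a x0 : R) - (t0 - 1).
  have [|//|[u uP]] := epigraph_separation _ _ f x0 (t0 - 1) f_proper f_e_convex.
    by rewrite fx0 lte_fin ltrBlDr ltrDl.
  by have := uP x0 x0_dom; rewrite ltxx.
(* By [subdiff_eq_dom], finiteness of the conjugate from above replaces checking the subgradient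
   inequality. *)
have sup_ge (w : couplingDual X) : edom (c_conjugate f) w ->
    (f x0 + (coupling x w - coupling x0 w) <=
     f x0 + ereal_sup [set (coupling x w - coupling x0 w)%E
                       | w in c_subdiff f x0])%E.
  move=> w_dom; rewrite leeD2l //; apply: ereal_sup_ubound.
  by exists w => //; rewrite subdiff_eq_dom.
set rhs := (X in (_ <= X)%E) in sup_ge *.
have rhs_ge r : (r%:E < f x)%E -> (r%:E <= rhs)%E.
  move=> /(epigraph_separation _ _ _ _ _ f_proper f_e_convex) [[a aP]|[u uP]].
    (* With [v = 0] and level 1 the coupling is finite everywhere. *)
    have [v vE] : exists v : topDual X, forall y, v y = 0.
      apply: (topDual_exists R X (fun=> 0)) => [c u v|y]; last exact: cvg_cst.
      by rewrite scaler0 addr0.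
    apply: le_trans (sup_ge (a, v, 1) _).
      rewrite /coupling !vE ltr01 fx0 -EFinB -EFinD lee_fin.
      (* Separation at [(x0, t0)] reads [r < t0 + a x - a x0]. *)
      by have := aP x0 t0; rewrite fx0 lexx => /(_ isT); lra.
    apply: edom_c_conjugate => // [y s /aP/ltW|y _]; first exact.
    by rewrite vE.
  (* At level [u x] the strict inequality fails at [x] but holds at [x0], so the term is [+oo]. *)
  apply: le_trans (sup_ge (a0, u, u x : R) _).
    by rewrite /coupling ltxx uP // fx0 -EFinN addye // addey // leey.
  by apply: edom_c_conjugate => // y s /a0P/ltW; exact.
(* It remains to let [r] increase to [f x], finite or [+oo]. *)
case E : (f x) => [t| |]; last by have := f_nny x; rewrite E.
- apply/lee_subgt0Pr => e e_gt0; rewrite -EFinB.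
  by apply: rhs_ge; rewrite E lte_fin ltrBlDr ltrDl.
- by rewrite (@eq_infty _ rhs) // => r; apply: rhs_ge; rewrite E ltry.
Qed.
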